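(* Let $\mathscr{A}\in\mathbb{R}^{I_1\times\cdots\times I_M\times I_1\times\cdots\times I_M}$, $\mathscr{C}\in\mathbb{R}^{J_1\times\cdots\times J_N\times J_1\times\cdots\times J_N}$, $\mathscr{D}\in\mathbb{R}^{I_1\times\cdots\times I_M\times J_1\times\cdots\times J_N}$, and let $\mathscr{X}^{(1)}\in\mathbb{R}^{I_1\times\cdots\times I_M\times J_1\times\cdots\times J_N}$ be any initial iteration tensor. Let $\mathscr{R}^{(k)},\mathscr{P}^{(k)}$ be the tensors generated by Algorithm G (defined in the context) started from $\mathscr{X}^{(1)}$, in exact arithmetic. Then the Sylvester tensor equation $\mathscr{A}*_M\mathscr{X}+\mathscr{X}*_N\mathscr{C}=\mathscr{D}$ is inconsistent (has no solution $\mathscr{X}\in\mathbb{R}^{I_1\times\cdots\times I_M\times J_1\times\cdots\times J_N}$) if and only if there exists a positive integer $k_0$ such that the algorithm generates $\mathscr{R}^{(k_0)}\neq0$ and $\mathscr{P}^{(k_0)}=0$.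
   Context: Einstein product: for $\mathscr{A}\in\mathbb{R}^{I_1\times\cdots\times I_M\times J_1\times\cdots\times J_N}$ and $\mathscr{B}\in\mathbb{R}^{J_1\times\cdots\times J_N\times K_1\times\cdots\times K_L}$, $(\mathscr{A}*_N\mathscr{B})_{i_1\dots i_Mk_1\dots k_L}=\sum_{j_1,\dots,j_N}\mathscr{A}_{i_1\dots i_Mj_1\dots j_N}\mathscr{B}_{j_1\dots j_Nk_1\dots k_L}$; the subscript of $*$ is the number of contracted modes. Transpose: for $\mathscr{A}\in\mathbb{R}^{I_1\times\cdots\times I_M\times J_1\times\cdots\times J_N}$, $\mathscr{A}^T\in\mathbb{R}^{J_1\times\cdots\times J_N\times I_1\times\cdots\times I_M}$ with $(\mathscr{A}^T)_{j_1\dots j_Ni_1\dots i_M}=\mathscr{A}_{i_1\dots i_Mj_1\dots j_N}$. $\|\cdot\|$ is the Frobenius norm (square root of the sum of squares of all entries). Algorithm G (input $\mathscr{A},\mathscr{C},\mathscr{D}$ and an initial tensor $\mathscr{X}^{(1)}$): set $\mathscr{R}^{(1)}=\mathscr{D}-\mathscr{A}*_M\mathscr{X}^{(1)}-\mathscr{X}^{(1)}*_N\mathscr{C}$ and $\mathscr{P}^{(1)}=\mathscr{A}^T*_M\mathscr{R}^{(1)}+\mathscr{R}^{(1)}*_N\mathscr{C}^T$. For $k=1,2,\dots$: if $\mathscr{R}^{(k)}=0$, or if $\mathscr{R}^{(k)}\ne0$ and $\mathscr{P}^{(k)}=0$, stop; otherwise set $$\mathscr{X}^{(k+1)}=\mathscr{X}^{(k)}+\frac{\|\mathscr{R}^{(k)}\|^2}{\|\mathscr{P}^{(k)}\|^2}\mathscr{P}^{(k)},\qquad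 \mathscr{R}^{(k+1)}=\mathscr{D}-\mathscr{A}*_M\mathscr{X}^{(k+1)}-\mathscr{X}^{(k+1)}*_N\mathscr{C},$$ $$\mathscr{P}^{(k+1)}=\mathscr{A}^T*_M\mathscr{R}^{(k+1)}+\mathscr{R}^{(k+1)}*_N\mathscr{C}^T+\frac{\|\mathscr{R}^{(k+1)}\|^2}{\|\mathscr{R}^{(k)}\|^2}\mathscr{P}^{(k)}.$$ *)

(* Defs.v *)
From HB Require Import structures.
From mathcomp Require Import all_boot all_order all_algebra.
From mathcomp Require Import reals.

Set Implicit Arguments.
Unset Strict Implicit.
Unset Printing Implicit Defensive.

Import Order.TTheory GRing.Theory Num.Theory.
Local Open Scope ring_scope.

Definition multi_index (M : nat) (I : 'I_M -> nat) :=
  {dffun forall m : 'I_M, 'I_(I m)}.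
HB.instance Definition _ (M : nat) (I : 'I_M -> nat) :=
  Finite.on (multi_index I).

(* tensor R I J is R^{I_1 x ... x I_M x J_1 x ... x J_N}: the entry
   a_{i_1 ... i_M j_1 ... j_N} of a is a (i, j), with i = (i_1, ..., i_M) and
   j = (j_1, ..., j_N). The codomain is R^o so that tensors inherit the
   lmodType structure of finite functions. *)
Definition tensor (R : realType) (M N : nat)
    (I : 'I_M -> nat) (J : 'I_N -> nat) :=
  {ffun multi_index I * multi_index J -> R^o}.
HB.instance Definition _ (R : realType) (M N : nat)
    (I : 'I_M -> nat) (J : 'I_N -> nat) := GRing.Lmodule.on (tensor R I J).

(* The number of contracted modes, the subscript of the Einstein product, is
   N here; it is determined by the types of the operands. *)
Definition einstein (R : realType) (M N L : nat)
    (I : 'I_M -> nat) (J : 'I_N -> nat) (K : 'I_L -> nat)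
    (A : tensor R I J) (B : tensor R J K) : tensor R I K :=
  [ffun ik => \sum_(j : multi_index J) A (ik.1, j) * B (j, ik.2)].

Notation "A *E B" := (einstein A B)
  (at level 40, left associativity, format "A  *E  B") : ring_scope.

Definition tensor_tr (R : realType) (M N : nat)
    (I : 'I_M -> nat) (J : 'I_N -> nat) (A : tensor R I J) : tensor R J I :=
  [ffun ji => A (ji.2, ji.1)].

Definition frobenius (R : realType) (M N : nat)
    (I : 'I_M -> nat) (J : 'I_N -> nat) (A : tensor R I J) : R :=
  Num.sqrt (\sum_(ij : multi_index I * multi_index J) A ij ^+ 2).

Section AlgorithmG.
Variables (R : realType) (M N : nat) (I : 'I_M -> nat) (J : 'I_N -> nat).
Variables (A : tensor R I I) (C : tensor R J J) (D : tensor R I J).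

Definition residual (X : tensor R I J) : tensor R I J :=
  D - A *E X - X *E C.

Definition sylvester_adj (Rk : tensor R I J) : tensor R I J :=
  tensor_tr A *E Rk + Rk *E tensor_tr C.

Definition next_X (Xk Rk Pk : tensor R I J) : tensor R I J :=
  Xk + (frobenius Rk ^+ 2 / frobenius Pk ^+ 2) *: Pk.

Definition next_P (Rk Pk Rk1 : tensor R I J) : tensor R I J :=
  sylvester_adj Rk1 + (frobenius Rk1 ^+ 2 / frobenius Rk ^+ 2) *: Pk.

Definition stops (Rk Pk : tensor R I J) : Prop :=
  Rk = 0 \/ (Rk <> 0 /\ Pk = 0).

(* algG X1 k Xk Rk Pk: started from X1, the algorithm reaches iteration k,
   counted from 1, with X^(k) = Xk, R^(k) = Rk and P^(k) = Pk. No triple is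
   generated for the iterations after the one where the algorithm stops. *)
Inductive algG (X1 : tensor R I J) :
    nat -> tensor R I J -> tensor R I J -> tensor R I J -> Prop :=
| algG_init :
    algG X1 1%N X1 (residual X1) (sylvester_adj (residual X1))
| algG_step k Xk Rk Pk :
    algG X1 k Xk Rk Pk -> ~ stops Rk Pk ->
    algG X1 k.+1 (next_X Xk Rk Pk) (residual (next_X Xk Rk Pk))
      (next_P Rk Pk (residual (next_X Xk Rk Pk))).

End AlgorithmG.

(* Main.v *)
Require Import Defs.
From mathcomp Require Import all_boot all_order all_algebra.
From mathcomp Require Import reals.
From mathcomp Require Import ring.

(** Write L X = A X + X C. Its adjoint for the Frobenius inner product is the
    map [sylvester_adj], written L^T below, so the iteration is Craig's method:
    conjugate gradients for L L^T Y = D with X = L^T Y, up to the shift by the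
    initial tensor.

    If X solves the equation, then <X - X^(k), P^(k)> = |R^(k)|^2 at every
    iteration ([error_dot_direction]): the new term L^T R contributes
    <L (X - X^(k)), R> = |R|^2, and the step length is the one that makes the
    error orthogonal to the previous direction. Hence P^(k) = 0 forces
    R^(k) = 0, and stopping with R^(k) <> 0 certifies inconsistency.

    Conversely, as long as it runs, the algorithm produces pairwise orthogonal
    residuals and pairwise orthogonal directions ([cg_orthogonal]). For an
    inconsistent equation no residual vanishes, so a run in which no direction
    vanished either would yield more nonzero pairwise orthogonal tensors than
    the dimension of the space ([orthogonal_family_size]). *)

Set Implicit Arguments.
Unset Strict Implicit.
Unset Printing Implicit Defensive.

Import Order.TTheory GRing.Theory Num.Theory.
Local Open Scope ring_scope.

(** * The inner product of finite families of reals *)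

Section Dot.
Variables (R : realType) (T : finType).
Implicit Types (u v w : {ffun T -> R^o}) (a : R).

Definition dot u v : R := \sum_t u t * v t.

Lemma dotC u v : dot u v = dot v u.
Proof. by apply: eq_bigr => t _; rewrite mulrC. Qed.

Lemma dotDl u v w : dot (u + v) w = dot u w + dot v w.
Proof. by rewrite -big_split; apply: eq_bigr => t _; rewrite ffunE mulrDl. Qed.

Lemma dotZl a u w : dot (a *: u) w = a * dot u w.
Proof. by rewrite mulr_sumr; apply: eq_bigr => t _; rewrite ffunE mulrA. Qed.

Lemma dotBl u v w : dot (u - v) w = dot u w - dot v w.
Proof. by rewrite -scaleN1r dotDl dotZl mulN1r. Qed.

Lemma dotDr u v w : dot w (u + v) = dot w u + dot w v.
Proof. by rewrite dotC dotDl !(dotC w). Qed.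

Lemma dotZr a u w : dot w (a *: u) = a * dot w u.
Proof. by rewrite dotC dotZl (dotC w). Qed.

Lemma dotBr u v w : dot w (u - v) = dot w u - dot w v.
Proof. by rewrite dotC dotBl !(dotC w). Qed.

Lemma dot0r u : dot u 0 = 0.
Proof. by rewrite -(subrr 0) dotBr subrr. Qed.

Lemma dot_eq0 u : (dot u u == 0) = (u == 0).
Proof.
apply/idP/eqP => [|->]; last by rewrite dot0r.
rewrite psumr_eq0 => [/allP u0|t _]; last by rewrite -expr2 sqr_ge0.
apply/ffunP => t; apply/eqP; rewrite ffunE.
by have := u0 t (mem_index_enum t); rewrite /= mulf_eq0 orbb.
Qed.

(** The Gram matrix of the family is diagonal with a nonzero diagonal, hence of
    full rank [n], while it factors through a space of dimension [#|T|]. *)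
Lemma orthogonal_family_size n (r : nat -> {ffun T -> R^o}) :
  (forall i, (i < n)%N -> r i != 0) ->
  (forall i j, (i < j < n)%N -> dot (r i) (r j) = 0) ->
  (n <= #|T|)%N.
Proof.
move=> r_neq0 r_orth.
pose B : 'M[R]_(n, #|T|) := \matrix_(i, j) r i (enum_val j).
have gramE : B *m B^T = diag_mx (\row_i dot (r i) (r i)).
  apply/matrixP => i j; rewrite !mxE.
  transitivity (dot (r i) (r j)).
    rewrite /dot [RHS](reindex _ (onW_bij _ (@enum_val_bij T))) /=.
    by apply: eq_bigr => k _; rewrite !mxE.
  have [->|neq_ij] := eqVneq i j; first by rewrite mulr1n.
  rewrite mulr0n; case: (ltngtP i j) => [lt_ij|lt_ji|/val_inj eq_ij].
  - by rewrite r_orth // lt_ij ltn_ord.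
  - by rewrite dotC r_orth // lt_ji ltn_ord.
  - by rewrite eq_ij eqxx in neq_ij.
have gram_unit : B *m B^T \in unitmx.
  rewrite gramE unitmxE det_diag unitfE; apply/prodf_neq0 => i _.
  by rewrite mxE dot_eq0 r_neq0.
rewrite -(mxrank_unit gram_unit).
exact: leq_trans (mxrankM_maxl _ _) (rank_leq_col _).
Qed.

End Dot.

(** * Orthogonality of residuals and directions *)

(** Both relations are proved by one simultaneous induction. Moving an operator
    to the other side of the inner product turns [L (p i)] into a combination
    of two residuals and [Lt (r i)] into a combination of two directions, which
    the induction hypothesis kills except at the last index; there the values
    of the two coefficients give the cancellation. *)
Lemma cg_orthogonal (R : realType) (T : finType)
    (L Lt : {ffun T -> R^o} -> {ffun T -> R^o})
    (r p : nat -> {ffun T -> R^o}) (n : nat) :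
  (forall u v, dot (L u) v = dot u (Lt v)) ->
  (forall k, r k.+1 = r k - (dot (r k) (r k) / dot (p k) (p k)) *: L (p k)) ->
  p 0 = Lt (r 0) ->
  (forall k, p k.+1 =
     Lt (r k.+1) + (dot (r k.+1) (r k.+1) / dot (r k) (r k)) *: p k) ->
  (forall k, (k < n)%N -> r k != 0 /\ p k != 0) ->
  forall i j, (i < j <= n)%N -> dot (r i) (r j) = 0 /\ dot (p i) (p j) = 0.
Proof.
move=> adj rS p0 pS.
elim: n => [|n IHn] neq0 i j; first by case: j => [|j]; rewrite ?ltn0 ?andbF.
have {}IHn := IHn (fun k lt_kn => neq0 k (leqW lt_kn)).
move=> /andP[lt_ij]; rewrite leq_eqVlt => /orP[/eqP jE|lt_jn]; last first.
  by apply: IHn; rewrite lt_ij.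
rewrite {j}jE ltnS in lt_ij *; rewrite (dotC (r i)) (dotC (p i)).
have [rn_neq0 pn_neq0] := neq0 n (leqnn _).
have rr_neq0 : dot (r n) (r n) != 0 by rewrite dot_eq0.
have pp_neq0 : dot (p n) (p n) != 0 by rewrite dot_eq0.
have dot_p_Lt k : (k <= n)%N -> dot (p n) (Lt (r k)) = dot (p n) (p k).
  case: k => [|k] lt_kn; first by rewrite p0.
  have [|_ pk_orth] := IHn k n; first by rewrite lt_kn leqnn.
  by rewrite pS dotDr dotZr [dot _ (p k)]dotC pk_orth mulr0 addr0.
have r_orth k : (k <= n)%N -> dot (r n.+1) (r k) = 0.
  move=> le_kn; rewrite rS dotBl dotZl adj dot_p_Lt //.
  move: le_kn; rewrite leq_eqVlt => /orP[/eqP->|lt_kn].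
    by rewrite divfK // subrr.
  have [|rk pk] := IHn k n; first by rewrite lt_kn leqnn.
  by rewrite dotC rk dotC pk mulr0 subrr.
split; first exact: r_orth.
have [ri_neq0 pi_neq0] := neq0 i lt_ij.
have ri_dot : dot (r i) (r i) != 0 by rewrite dot_eq0.
have pi_dot : dot (p i) (p i) != 0 by rewrite dot_eq0.
(* The residual recurrence expresses L (p i) through r i and r i.+1. *)
have Lp : dot (Lt (r n.+1)) (p i)
    = - (dot (p i) (p i) / dot (r i) (r i)) * dot (r n.+1) (r i.+1).
  have := congr1 (dot (r n.+1)) (rS i).
  rewrite dotBr dotZr (r_orth i) // [dot _ (L _)]dotC adj (dotC (p i) (Lt _)) => ->.
  by field; rewrite pi_dot ri_dot.
rewrite pS dotDl dotZl Lp.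
move: lt_ij; rewrite leq_eqVlt => /orP[/eqP ->|lt_in].
  by field.
have [|_ pi_orth] := IHn i n; first by rewrite lt_in leqnn.
by rewrite r_orth // dotC pi_orth !mulr0 addr0.
Qed.

(** * The Sylvester operator and its adjoint *)

Section Sylvester.
Variables (R : realType) (M N : nat) (I : 'I_M -> nat) (J : 'I_N -> nat).
Variables (A : tensor R I I) (C : tensor R J J) (D : tensor R I J).
Implicit Types X Y P : tensor R I J.

Definition sylvester X : tensor R I J := A *E X + X *E C.

Lemma frobenius_sqr X : frobenius X ^+ 2 = dot X X.
Proof.
rewrite sqr_sqrtr; last by apply: sumr_ge0 => t _; exact: sqr_ge0.
by apply: eq_bigr => t _; rewrite expr2.
Qed.

Lemma sylvesterDZ X a P : sylvester (X + a *: P) = sylvester X + a *: sylvester P.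
Proof.
apply/ffunP => ij; rewrite !ffunE.
rewrite scalerDr addrACA; congr (_ + _); rewrite scaler_sumr -big_split /=.
  by apply: eq_bigr => k _; rewrite !ffunE mulrDr mulrCA.
by apply: eq_bigr => k _; rewrite !ffunE mulrDl scalerAl.
Qed.

Lemma sylvesterB X Y : sylvester (X - Y) = sylvester X - sylvester Y.
Proof. by rewrite -scaleN1r sylvesterDZ scaleN1r. Qed.

Lemma dot_sylvester X Y : dot (sylvester X) Y = dot X (sylvester_adj A C Y).
Proof.
rewrite dotDl dotDr /dot; congr (_ + _).
- transitivity (\sum_i \sum_j \sum_k A (i, k) * X (k, j) * Y (i, j)).
    rewrite pair_big /=; apply: eq_bigr => -[i j] _.
    by rewrite ffunE mulr_suml.
  transitivity (\sum_k \sum_j \sum_i A (i, k) * X (k, j) * Y (i, j)).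
    under eq_bigr do rewrite exchange_big /=.
    rewrite exchange_big /=; apply: eq_bigr => k _.
    exact: exchange_big.
  rewrite pair_big /=; apply: eq_bigr => -[k j] _.
  rewrite ffunE mulr_sumr; apply: eq_bigr => i _.
  by rewrite ffunE /= [A _ * _]mulrC mulrA.
- transitivity (\sum_i \sum_j \sum_k X (i, k) * C (k, j) * Y (i, j)).
    rewrite pair_big /=; apply: eq_bigr => -[i j] _.
    by rewrite ffunE mulr_suml.
  transitivity (\sum_i \sum_k \sum_j X (i, k) * C (k, j) * Y (i, j)).
    by apply: eq_bigr => i _; rewrite exchange_big.
  rewrite pair_big /=; apply: eq_bigr => -[i k] _.
  rewrite ffunE mulr_sumr; apply: eq_bigr => j _.
  by rewrite ffunE /= -mulrA [C _ * _]mulrC.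
Qed.

Lemma residualE X : residual A C D X = D - sylvester X.
Proof. by rewrite /residual /sylvester opprD addrA. Qed.

Lemma residualDZ X a P :
  residual A C D (X + a *: P) = residual A C D X - a *: sylvester P.
Proof. by rewrite !residualE sylvesterDZ opprD addrA. Qed.

(** * Consistent equations *)

(** The step length [|R|^2 / |P|^2] is chosen exactly so that the error after
    the step is orthogonal to [P]; the only contribution to the next value then
    comes from the term [sylvester_adj R]. *)
Lemma error_dot_direction X X1 k Xk Rk Pk :
  sylvester X = D -> algG A C D X1 k Xk Rk Pk -> dot (X - Xk) Pk = dot Rk Rk.
Proof.
move=> solX.
have grad Y : dot (X - Y) (sylvester_adj A C (residual A C D Y))
    = dot (residual A C D Y) (residual A C D Y).
  by rewrite -dot_sylvester sylvesterB solX residualE.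
elim=> [|{}k {}Xk {}Rk {}Pk _ IH nstop]; first exact: grad.
suff orth : dot (X - next_X Xk Rk Pk) Pk = 0.
  by rewrite dotDr grad dotZr orth mulr0 addr0.
rewrite /next_X opprD addrA dotBl IH dotZl !frobenius_sqr divfK ?subrr //.
rewrite dot_eq0; apply/negP => /eqP P0; case: nstop.
by have [R0|/eqP R_neq0] := eqVneq Rk 0; [left|right].
Qed.

(** * Inconsistent equations *)

(** The recurrences of the algorithm run without the stopping test, so that the
    iterates form sequences to which [cg_orthogonal] applies; index [k]
    corresponds to iteration [k.+1] of the algorithm. *)
Fixpoint cg_state (X1 : tensor R I J) (k : nat) : tensor R I J * tensor R I J :=
  if k is k'.+1 then
    let: (X, P) := cg_state X1 k' in
    let X' := next_X X (residual A C D X) P in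
    (X', next_P A C (residual A C D X) P (residual A C D X'))
  else (X1, sylvester_adj A C (residual A C D X1)).

Definition cg_X X1 k := (cg_state X1 k).1.
Definition cg_R X1 k := residual A C D (cg_X X1 k).
Definition cg_P X1 k := (cg_state X1 k).2.

Lemma cg_XS X1 k : cg_X X1 k.+1 = next_X (cg_X X1 k) (cg_R X1 k) (cg_P X1 k).
Proof. by rewrite /cg_R /cg_X /cg_P /=; case: cg_state. Qed.

Lemma cg_PS X1 k :
  cg_P X1 k.+1 = next_P A C (cg_R X1 k) (cg_P X1 k) (cg_R X1 k.+1).
Proof. by rewrite /cg_R cg_XS /cg_R /cg_X /cg_P /=; case: cg_state. Qed.

Lemma algG_cg X1 n :
  (forall k, (k < n)%N -> cg_R X1 k != 0 /\ cg_P X1 k != 0) ->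
  algG A C D X1 n.+1 (cg_X X1 n) (cg_R X1 n) (cg_P X1 n).
Proof.
elim: n => [|n IHn] neq0; first exact: algG_init.
rewrite cg_PS /cg_R cg_XS; apply: algG_step.
  by apply: IHn => k lt_kn; apply/neq0/ltnW.
by have [/eqP R_neq0 /eqP P_neq0] := neq0 n (leqnn _); case=> [|[_]].
Qed.

Lemma cg_breakdown X1 n :
  (#|{: multi_index I * multi_index J}| < n)%N ->
  ~ (forall k, (k < n)%N -> cg_R X1 k != 0 /\ cg_P X1 k != 0).
Proof.
move=> lt_dim_n neq0; move: lt_dim_n; apply/negP; rewrite -leqNgt.
apply: (@orthogonal_family_size R _ n (cg_R X1)) => [k /neq0[]//|i j /andP[lt_ij lt_jn]].
have [] // := @cg_orthogonal R _ sylvester (sylvester_adj A C)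
  (cg_R X1) (cg_P X1) n dot_sylvester _ _ _ neq0 i j; last by rewrite lt_ij ltnW.
- by move=> k; rewrite {1}/cg_R cg_XS residualDZ !frobenius_sqr.
- by move=> k; rewrite cg_PS /next_P !frobenius_sqr.
Qed.

End Sylvester.

Theorem theorem3p2 (R : realType) (M N : nat)
    (I : 'I_M -> nat) (J : 'I_N -> nat)
    (A : tensor R I I) (C : tensor R J J) (D X1 : tensor R I J) :
  (~ exists X : tensor R I J, A *E X + X *E C = D) <->
  (exists (k0 : nat) (Xk Rk Pk : tensor R I J),
     (0 < k0)%N /\ algG A C D X1 k0 Xk Rk Pk /\ Rk <> 0 /\ Pk = 0).
Proof.
split=> [incons|[k [Xk [Rk [Pk [_ [run [R_neq0 P0]]]]]]] [X solX]]; last first.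
  apply/R_neq0/eqP; rewrite -dot_eq0 -(error_dot_direction solX run) P0.
  by rewrite dot0r.
have R_neq0 X : residual A C D X != 0.
  apply/negP; rewrite residualE subr_eq0 => /eqP solX.
  by apply: incons; exists X; rewrite solX.
set n := #|{: multi_index I * multi_index J}|.
have ex_P0 : exists k, cg_P A C D X1 k == 0.
  case: (boolP [exists k : 'I_n.+1, cg_P A C D X1 k == 0]).
    by case/existsP=> k P0; exists k.
  rewrite negb_exists => /forallP P_neq0.
  have [] := @cg_breakdown R M N I J A C D X1 n.+1 (leqnn _).
  by move=> k lt_kn; split; [exact: R_neq0|exact: (P_neq0 (Ordinal lt_kn))].
(* The first vanishing direction is the one that the algorithm reaches. *)
case: (ex_minnP ex_P0) => k /eqP P0 k_min.
exists k.+1, (cg_X A C D X1 k), (cg_R A C D X1 k), (cg_P A C D X1 k).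
split=> //; split; last by split=> //; apply/eqP/R_neq0.
apply: algG_cg => j lt_jk; split; first exact: R_neq0.
by apply/negP => /k_min; rewrite leqNgt lt_jk.
Qed.
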